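(* Let $p,q\in[1,\infty)$ and assume that $p<q$. Then there is no coarse map from $J_p$ to $J_q$ that is linearly expanding at rate $1/q$.
   Context: The James sequence space $J_p$ is the Banach space of all $x=(x(n))_n\in\mathbb R^{\mathbb N}$ with $\lim_nx(n)=0$ and $\|x\|_{J_p}=\sup_{p_1<\dots<p_n}\left(\sum_{i=2}^n|x(p_i)-x(p_{i-1})|^p\right)^{1/p}<\infty$, the supremum being over all finite increasing sequences $p_1<\dots<p_n$ in $\mathbb N$, with this norm. A map $f\colon X\to Y$ between Banach spaces is coarse if $\omega_f(t)=\sup\{\|f(x)-f(z)\| : \|x-z\|\le t\}<\infty$ for all $t\ge 0$. For $\alpha\in[0,1]$, a map $f\colon X\to Y$ between Banach spaces is linearly expanding at rate $\alpha$ if for every $L>0$ there is $C>0$ such that, for all $x,z\in X$, $\|x-z\|\ge L\max\{\|x\|^\alpha,\|z\|^\alpha\}+L$ implies $\|f(x)-f(z)\|\ge\frac1C\|x-z\|-C$. *)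

(* Defs.v *)
From HB Require Import structures.
From mathcomp Require Import all_boot all_order all_algebra.
From mathcomp Require Import all_classical all_reals all_analysis.

Set Implicit Arguments.
Unset Strict Implicit.
Unset Printing Implicit Defensive.
Import Order.TTheory GRing.Theory Num.Theory.
Import numFieldNormedType.Exports.
Local Open Scope classical_set_scope.
Local Open Scope ring_scope.

Section variation.
Context {R : realType}.
Implicit Types (p : R) (x y : nat -> R) (s : seq nat).

Definition variation p x s : R :=
  \sum_(1 <= i < size s) `|x (nth 0%N s i) - x (nth 0%N s i.-1)| `^ p.

Definition james_enorm p x : \bar R :=
  ereal_sup [set ((variation p x s) `^ p^-1)%:E | s in [set s | sorted ltn s]].

(* The proof of [1 <= p] is unused in the body; it indexes the predicate so
   that its closure under the linear operations, which needs it, can be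
   declared as a canonical instance. *)
Definition james_seq p (p1 : 1 <= p) : {pred (nat -> R)} :=
  fun x => `[< x @ \oo --> (0 : R) /\ (james_enorm p x < +oo)%E >].

Lemma variation_ge0 p x s : 0 <= variation p x s.
Proof. by apply: sumr_ge0 => i _; exact: powR_ge0. Qed.

Lemma le_james_enormP p x (M : R) : 0 < p -> 0 <= M ->
  (james_enorm p x <= M%:E)%E <->
  (forall s, sorted ltn s -> variation p x s <= M `^ p).
Proof.
move=> p0 M0; split=> [/ereal_supP h s ss|h].
  have := h _ (ex_intro2 _ _ s ss erefl); rewrite lee_fin => hs.
  rewrite -[leLHS]powRr1 ?variation_ge0// -[1](mulVf (lt0r_neq0 p0)) powRrM.
  by apply: ge0_ler_powR; rewrite ?nnegrE ?powR_ge0// ltW.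
apply/ereal_supP => _ [s ss <-]; rewrite lee_fin.
rewrite -[leRHS]powRr1// -[1](mulfV (lt0r_neq0 p0)) powRrM.
apply: ge0_ler_powR; rewrite ?nnegrE ?powR_ge0 ?variation_ge0 ?invr_ge0 ?(ltW p0)//.
exact: h.
Qed.

Lemma powR_minkowski p (a b A B : R) : 1 <= p -> 0 < A -> 0 < B ->
  `|a + b| `^ p <= (A + B) `^ p *
    (A / (A + B) * (`|a| `^ p / A `^ p) + B / (A + B) * (`|b| `^ p / B `^ p)).
Proof.
move=> p1 A0 B0; have p0 : 0 <= p by apply: le_trans p1.
have AB0 : 0 < A + B by exact: addr_gt0.
have t01 : 0 <= A / (A + B) <= 1.
  by rewrite divr_ge0 ?(ltW A0) ?(ltW AB0)//= ler_pdivrMr// mul1r lerDl ltW.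
have onemE : 1 - A / (A + B) = B / (A + B).
  by rewrite -{1}(divff (lt0r_neq0 AB0)) -mulrBl addrC addKr.
have := convex_powR p1 (Itv01 (andP t01).1 (andP t01).2)
  (x := `|a| / A) (y := `|b| / B).
rewrite !inE/= !in_itv/= !andbT.
rewrite !divr_ge0 ?(ltW A0) ?(ltW B0)// => /(_ isT isT).
rewrite [X in X `^ _ <= _ -> _]convRE convRE /= /unstable.onem onemE.
have powV (u U : R) : 0 <= u -> 0 < U -> (u / U) `^ p = u `^ p / U `^ p.
  move=> u0 U0; rewrite powRM ?invr_ge0 ?(ltW U0)//.
  by rewrite -powR_inv1 ?(ltW U0)// -powRrM mulN1r powRN.
rewrite !powV// => h.
apply: (@le_trans _ _ ((`|a| + `|b|) `^ p)).
  by apply: ge0_ler_powR; rewrite ?nnegrE ?addr_ge0// ler_normD.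
rewrite (_ : `|a| + `|b| = (A + B) *
    (A / (A + B) * (`|a| / A) + B / (A + B) * (`|b| / B))); last first.
  rewrite mulrDr !mulrA [_ * A]mulrC [_ * B]mulrC !mulfK ?gt_eqF//.
  by rewrite ![_ * `|_|]mulrC !mulfK ?gt_eqF.
rewrite powRM ?(ltW AB0)//; last first.
  by rewrite addr_ge0// !mulr_ge0// ?invr_ge0 ltW.
by rewrite ler_wpM2l// powR_ge0.
Qed.

Lemma variationD p x y s (A B : R) : 1 <= p -> 0 < A -> 0 < B ->
  variation p x s <= A `^ p -> variation p y s <= B `^ p ->
  variation p (fun n => x n + y n) s <= (A + B) `^ p.
Proof.
move=> p1 A0 B0 xA yB.
have AB0 : 0 < A + B by exact: addr_gt0.
rewrite /variation.
under eq_bigr do rewrite opprD addrACA.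
apply: le_trans.
  by apply: ler_sum => i _; exact: (powR_minkowski _ _ p1 A0 B0).
rewrite -mulr_sumr big_split/= -!mulr_sumr -!mulr_suml.
rewrite -[leRHS]mulr1 ler_wpM2l ?powR_ge0//.
apply: (@le_trans _ _ (A / (A + B) * 1 + B / (A + B) * 1)).
  by apply: lerD; apply: ler_wpM2l; rewrite ?divr_ge0 ?(ltW A0) ?(ltW B0) ?(ltW AB0)//
    ?ler_pdivrMr ?powR_gt0// ?mul1r.
by rewrite !mulr1 -mulrDl divff ?gt_eqF.
Qed.

Lemma variationZ p x s (a : R) :
  variation p (fun n => a * x n) s = `|a| `^ p * variation p x s.
Proof.
rewrite /variation mulr_sumr; apply: eq_bigr => i _.
by rewrite -mulrBr normrM powRM.
Qed.

Lemma variation2 p x m n : variation p x [:: m; n] = `|x n - x m| `^ p.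
Proof. by rewrite /variation big_nat1. Qed.

Lemma variation_small p s (e : R) : 0 < p -> 0 < e ->
  exists2 d : R, 0 < d &
    forall x, (forall i, `|x (nth 0%N s i)| <= d) -> variation p x s <= e `^ p.
Proof.
move=> p0 e0; pose k : R := (size s).+1%:R.
have k0 : 0 < k by rewrite ltr0n.
pose c := e `^ p / k; have c0 : 0 < c by rewrite divr_gt0 ?powR_gt0.
exists (c `^ p^-1 / 2) => [|x xd]; first by rewrite divr_gt0 ?powR_gt0.
apply: (@le_trans _ _ (\sum_(1 <= i < size s) c)).
  apply: ler_sum => i _.
  rewrite -[leRHS]powRr1 ?(ltW c0)// -[1](mulVf (lt0r_neq0 p0)) powRrM.
  apply: ge0_ler_powR; rewrite ?nnegrE ?powR_ge0 ?(ltW p0)//.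
  by rewrite (le_trans (ler_normB _ _))// [leRHS]splitr lerD.
rewrite sumr_const_nat -mulr_natr /c -mulrA ler_piMr ?powR_ge0//.
by rewrite mulrC ler_pdivrMr// mul1r ler_nat; case: (size s) => // n; rewrite subn1 /= ltnW.
Qed.

End variation.

Record james (R : realType) (p : R) (p1 : 1 <= p) := James {
  james_val :> nat -> R ;
  james_valP : james_val \in james_seq p1 }.

Section james_lmodule.
Context {R : realType} (p : R) (p1 : 1 <= p).

Let p0 : 0 < p. Proof. exact: lt_le_trans p1. Qed.

Lemma james_seqP (x : nat -> R) : x \in james_seq p1 <->
  x @ \oo --> (0 : R) /\ exists2 M : R, 0 < M &
    forall s, sorted ltn s -> variation p x s <= M `^ p.
Proof.
rewrite unfold_in; split=> [/asboolP[x0 xoo]|[x0 [M M0 xM]]].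
  split=> //; have [M M0 xM] : exists2 M : R, 0 < M & (james_enorm p x <= M%:E)%E.
    case: (james_enorm p x) xoo => [r| |]// _.
      by exists (Num.max 1 r); rewrite ?lee_fin ?le_max ?lexx ?lt_max ?ltr01 ?orbT.
    by exists 1 => //; rewrite leNye.
  by exists M => //; apply/le_james_enormP => //; exact: ltW.
apply/asboolP; split=> //; apply: (@le_lt_trans _ _ M%:E); last exact: ltry.
by apply/le_james_enormP => //; exact: ltW.
Qed.

Lemma james_seq_submod_closed : submod_closed (james_seq p1).
Proof.
split=> [|a x y /james_seqP[x0 [A A0 xA]] /james_seqP[y0 [B B0 yB]]].
  apply/james_seqP; split; first exact: cvg_cst.
  exists 1 => // s _; rewrite /variation big1 ?powR_ge0// => i _.
  by rewrite subrr normr0 powR0// gt_eqF.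
apply/james_seqP; split.
  rewrite -[X in _ --> X](addr0 (0 : R)); apply: cvgD => //.
  rewrite -[X in _ --> X](mulr0 a); exact: cvgMr.
have A'0 : 0 < (`|a| + 1) * A by rewrite mulr_gt0// ltr_wpDl.
exists ((`|a| + 1) * A + B) => [|s ss]; first by rewrite addr_gt0.
apply: variationD => //; last exact: yB.
rewrite [leLHS](variationZ p x s a) powRM ?(ltW A0) ?addr_ge0//.
apply: ler_pM; rewrite ?powR_ge0 ?variation_ge0//; last exact: xA.
by apply: ge0_ler_powR; rewrite ?nnegrE ?addr_ge0 ?lerDl// ltW.
Qed.

HB.instance Definition _ := GRing.isSubmodClosed.Build R (nat -> R)
  (james_seq p1) james_seq_submod_closed.

HB.instance Definition _ := [isSub for @james_val R p p1].
HB.instance Definition _ := [Choice of james p1 by <:].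
HB.instance Definition _ := [SubChoice_isSubLmodule of james p1 by <:].

Definition james_norm (x : james p1) : R := fine (james_enorm p x).

Lemma james_enorm_ge0 (x : nat -> R) : (0 <= james_enorm p x)%E.
Proof.
apply: (@le_trans _ _ ((variation p x [::]) `^ p^-1)%:E).
  by rewrite lee_fin powR_ge0.
by apply: ereal_sup_ubound; exists [::].
Qed.

Lemma james_normE (x : james p1) : (james_norm x)%:E = james_enorm p x.
Proof.
rewrite /james_norm fineK// ge0_fin_numE ?james_enorm_ge0//.
by have := james_valP x; rewrite unfold_in => /asboolP[].
Qed.

Lemma james_norm_ge0 (x : james p1) : 0 <= james_norm x.
Proof. by rewrite fine_ge0// james_enorm_ge0. Qed.

Lemma le_james_normP (x : james p1) (M : R) : 0 <= M ->
  james_norm x <= M <->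
  (forall s, sorted ltn s -> variation p x s <= M `^ p).
Proof. by move=> M0; rewrite -lee_fin james_normE; exact: le_james_enormP. Qed.

Lemma james_cvg0 (x : james p1) : x n @[n --> \oo] --> (0 : R).
Proof. by have /james_seqP[] := james_valP x. Qed.

Lemma ler_james_normD (x y : james p1) :
  james_norm (x + y) <= james_norm x + james_norm y.
Proof.
apply/ler_addgt0Pr => e e0.
rewrite [e]splitr addrACA.
have h (z : james p1) : 0 < james_norm z + e / 2.
  by rewrite ltr_wpDl ?james_norm_ge0// divr_gt0.
apply/le_james_normP => [|s ss]; first by rewrite addr_ge0// ltW.
have hv (z : james p1) : variation p z s <= (james_norm z + e / 2) `^ p.
  by apply: (le_james_normP z (ltW (h z))).1 => //; rewrite lerDl divr_ge0 ?ltW.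
exact: (variationD p1 (h x) (h y) (hv x) (hv y)).
Qed.

Lemma ler_james_norm_distance (x : james p1) m n :
  (m < n)%N -> `|x n - x m| <= james_norm x.
Proof.
move=> mn; have := (le_james_normP x (james_norm_ge0 x)).1 (lexx _) [:: m; n].
rewrite /= mn => /(_ isT).
have pV0 : 0 <= p^-1 by rewrite invr_ge0 ltW.
rewrite variation2 => /(ge0_ler_powR pV0).
rewrite !nnegrE !powR_ge0 -!powRrM mulfV ?gt_eqF//.
by rewrite !powRr1 ?james_norm_ge0//; exact.
Qed.

Lemma ler_james_norm (x : james p1) n : `|x n| <= james_norm x.
Proof.
have cx : `|x n - x m| @[m --> \oo] --> `|x n - 0|.
  by apply: cvg_norm; apply: cvgB; [exact: cvg_cst|exact: james_cvg0].
rewrite -[x n]subr0 -(cvg_lim _ cx)//; apply: limr_le; first by apply/cvg_ex; eexists; exact: cx.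
near=> m; rewrite distrC; apply: ler_james_norm_distance.
by near: m; exact: nbhs_infty_gt.
Unshelve. all: by end_near. Qed.

Lemma james_normr0_eq0 (x : james p1) : james_norm x = 0 -> x = 0.
Proof.
move=> x0; apply/val_inj/funext => n /=.
by apply/eqP; rewrite -normr_le0 -x0 ler_james_norm.
Qed.

Lemma james_normrZ (a : R) (x : james p1) :
  james_norm (a *: x) = `|a| * james_norm x.
Proof.
have le_norm (b : R) (y : james p1) :
    james_norm (b *: y) <= `|b| * james_norm y.
  have b0 : 0 <= `|b| * james_norm y by rewrite mulr_ge0 ?james_norm_ge0.
  apply/le_james_normP => // s ss.
  rewrite [leLHS](variationZ p y s b) powRM ?james_norm_ge0//.
  by rewrite ler_wpM2l ?powR_ge0//; apply: (le_james_normP y (james_norm_ge0 y)).1.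
apply/eqP; rewrite eq_le le_norm/=.
have [->|a0] := eqVneq a 0; first by rewrite normr0 mul0r james_norm_ge0.
have := le_norm a^-1 (a *: x); rewrite scalerA mulVf// scale1r normfV.
by rewrite mulrC ler_pdivlMr ?normr_gt0// mulrC.
Qed.

HB.instance Definition _ := Lmodule_isNormed.Build R (james p1)
  ler_james_normD james_normrZ james_normr0_eq0.

Lemma james_normrE (x : james p1) : `|x| = james_norm x.
Proof. by []. Qed.

Lemma cauchy_cvg_james (F : set_system (james p1)) :
  ProperFilter F -> cauchy F -> cvg F.
Proof.
move=> FF Fc.
have Fball (e : R) : 0 < e -> exists x0 : james p1, \forall x \near F, `|x0 - x| < e.
  by move=> e0; have /cauchyP/(_ e e0)[x0] := Fc; rewrite -ball_normE; exists x0.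
have cF n : cvg ((fun x : james p1 => x n : R) @ F).
  apply: cauchy_cvg; apply: cauchy_exP => e e0.
  have [x0 Fx0] := Fball _ e0; exists (x0 n).
  rewrite -ball_normE /fmap/=; apply: filterS Fx0 => x /=.
  by apply: le_lt_trans; exact: (ler_james_norm (x0 - x) n).
pose y n : R := lim ((fun x : james p1 => x n : R) @ F).
have yE n : (fun x : james p1 => x n : R) @ F --> y n by exact: cF.
have key (e : R) : 0 < e -> exists x0 : james p1,
    [/\ \forall x \near F, `|x0 - x| < e,
       forall n, `|x0 n - y n| <= e &
       forall s, sorted ltn s ->
         variation p (fun n => x0 n - y n) s <= (e + e) `^ p].
  move=> e0; have [x0 Fx0] := Fball _ e0; exists x0; split=> // [n|s ss].
    apply: (@closed_cvg _ _ F _ (fun x : james p1 => `|x0 n - x n|)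
      (fun r => r <= e) (@closed_le _ e)); last first.
      by apply: cvg_norm; apply: cvgB; [exact: cvg_cst|exact: yE].
    apply: filterS Fx0 => x /ltW; apply: le_trans.
    exact: (ler_james_norm (x0 - x) n).
  have [d d0 small] := variation_small s p0 e0.
  have Fy : F [set x : james p1 | forall i : 'I_(size s).+1,
      `|y (nth 0%N s i) - x (nth 0%N s i)| <= d].
    apply: filter_forall => i.
    by move/cvgrPdist_le: (yE (nth 0%N s i)); apply.
  have [x [x0x yx]] := filter_ex (filterI Fx0 Fy).
  rewrite (_ : (fun n => x0 n - y n) =
    (fun n => (x0 n - x n) + (x n - y n))); last first.
    by apply/funext => n; rewrite addrA subrK.
  apply: variationD => //; last first.
    apply: small => i; rewrite distrC.
    have [si|si] := ltnP i (size s).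
      exact: (yx (Ordinal (leqW si))).
    by rewrite nth_default//; have := yx ord_max; rewrite /= nth_default.
  have h : james_norm (x0 - x) <= e by exact: ltW.
  exact: (le_james_normP _ (ltW e0)).1 h s ss.
have y0 : y @ \oo --> (0 : R).
  apply/cvgrPdist_le => e e0.
  have e20 : 0 < e / 2 by rewrite divr_gt0.
  have [x0 [_ x0y _]] := key _ e20.
  have /cvgrPdist_le/(_ _ e20) := james_cvg0 x0.
  apply: filterS => n; rewrite !sub0r !normrN => x0n.
  rewrite -[y n](subKr (x0 n)) (le_trans (ler_normB _ _))//.
  by rewrite [leRHS]splitr lerD.
have yJ : y \in james_seq p1.
  have [x0 [_ _ x0y]] := key 1 ltr01.
  have zJ : (x0 : nat -> R) - y \in james_seq p1.
    apply/james_seqP; split; last by exists (1 + 1) => //; rewrite addr_gt0.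
    by rewrite -[X in _ --> X](subr0 (0 : R)); apply: cvgB => //; exact: james_cvg0.
  have yE' : y = - 1 *: ((x0 : nat -> R) - y) + (x0 : nat -> R).
    apply/funext => n.
    transitivity (- 1 * (x0 n - y n) + x0 n) => //.
    by rewrite mulN1r opprB subrK.
  by rewrite yE'; exact: james_seq_submod_closed.2 zJ (james_valP x0).
apply/cvg_ex; exists (James yJ); apply/cvgrPdist_lt => /= e e0.
have e20 : 0 < e / 2 by rewrite divr_gt0.
have e40 : 0 < e / 2 / 2 by rewrite divr_gt0.
have [x0 [Fx0 _ x0y]] := key _ e40.
have x0Y : `|x0 - James yJ| <= e / 2.
  rewrite -splitr in x0y.
  exact: (le_james_normP (x0 - James yJ) (ltW e20)).2 x0y.
apply: filterS Fx0 => x x0x.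
rewrite -(subrKA x0) (le_lt_trans (ler_normD _ _))// [`|James yJ - _|]distrC.
apply: (lt_trans (ler_ltD x0Y x0x)).
by rewrite [ltRHS]splitr ltrD2l ltr_pdivrMr// ltr_pMr// ltr1n.
Qed.

HB.instance Definition _ := Uniform_isComplete.Build (james p1) cauchy_cvg_james.
End james_lmodule.

Section coarse_maps.
Context {R : realType} {X Y : completeNormedModType R}.
Implicit Types (f : X -> Y) (t alpha : R).

Definition expansion_modulus f t : \bar R :=
  ereal_sup [set `|f xz.1 - f xz.2|%:E |
    xz in [set xz : X * X | `|xz.1 - xz.2| <= t]].

Definition coarse f : Prop :=
  forall t, 0 <= t -> (expansion_modulus f t < +oo)%E.

(* Meant for [alpha] in [0, 1]. With [powR], [0 `^ 0 = 1] and
   [0 `^ alpha = 0] for [alpha > 0]. *)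
Definition linearly_expanding alpha f : Prop :=
  forall L : R, 0 < L -> exists2 C : R, 0 < C &
    forall x z : X,
      L * Num.max (`|x| `^ alpha) (`|z| `^ alpha) + L <= `|x - z| ->
      C^-1 * `|x - z| - C <= `|f x - f z|.

End coarse_maps.

(* Main.v *)
(* Fix an ultrafilter U finer than [\oo] and let X n be the sum of the initial
   segments 1_{[0, a)} for a in the list n of length k.  Changing one entry of n
   moves X n by at most 2, so g n := f (X n) moves by at most a constant w.
   Bounded sequences have pointwise limits along U, hence g has iterated limits
   g_j(n_1, ..., n_j), living in the bidual of J_q, i.e. sequences of bounded
   q-variation that need not tend to 0.  Pick n_1 < m_1 < n_2 < m_2 < ... one at
   a time, each far along U, and let D_j := g_j(n) - g_j(m).  The numbers are
   chosen so that D_(j+1) is as well behaved as D_j on a finite initial segment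
   [0, N_j), beyond which D_j is already small, and so that the values at
   infinity of g_j(n) and g_j(m) stay close.  As D_(j+1) - D_j has norm at most
   2w, each step costs at most a constant times w^q in q-variation, so that
   |g n - g m| = O(k^(1/q)).  But |X n - X m| >= k^(1/p) since n and m interlace,
   while |X n|, |X m| <= k, and this contradicts linear expansion at rate 1/q
   for large k. *)

Require Import Defs.
From mathcomp Require Import all_boot all_order all_algebra.
From mathcomp Require Import all_classical all_reals all_analysis.
From mathcomp Require Import lra.
(* [all_analysis] has its own [variation]. *)
Import Defs.

Set Implicit Arguments.
Unset Strict Implicit.
Unset Printing Implicit Defensive.
Import Order.TTheory GRing.Theory Num.Theory.
Import numFieldNormedType.Exports.
Local Open Scope classical_set_scope.
Local Open Scope ring_scope.

(** * Sequences of bounded q-variation *)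

Section variation_lemmas.
Context {R : realType}.
Implicit Types (p q w : R) (x y : nat -> R) (s t : seq nat).

Lemma variation_nil q x : variation q x [::] = 0.
Proof. by rewrite /variation big_geq. Qed.

Lemma variation_seq1 q x a : variation q x [:: a] = 0.
Proof. by rewrite /variation big_geq. Qed.

Lemma variation_cons q x a b s :
  variation q x [:: a, b & s] = `|x b - x a| `^ q + variation q x (b :: s).
Proof.
rewrite /variation big_ltn//=; congr (_ + _).
by rewrite big_add1 /=; apply: eq_big_nat => -[|i].
Qed.

(** Only the increment across the junction of [s] and [t] is new. *)
Lemma le_variation_cat q x s t (M : R) : 0 <= q -> 0 <= M ->
  (forall i j, `|x i - x j| <= M) ->
  variation q x (s ++ t) <= variation q x s + variation q x t + M `^ q.
Proof.
move=> q0 M0 xM; elim: s => [|a [|b s] IH].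
- by rewrite variation_nil add0r lerDl powR_ge0.
- rewrite variation_seq1 add0r; case: t {IH} => [|b t].
    by rewrite variation_seq1 variation_nil add0r powR_ge0.
  rewrite variation_cons addrC lerD2l ge0_ler_powR ?nnegrE//.
- by rewrite /= !variation_cons -!addrA lerD2l !addrA.
Qed.

Lemma variation_cat_ge q x s t :
  variation q x s + variation q x t <= variation q x (s ++ t).
Proof.
elim: s => [|a [|b s] IH]; first by rewrite variation_nil add0r.
- rewrite variation_seq1 add0r; case: t {IH} => [|b t].
    by rewrite variation_nil variation_seq1.
  by rewrite variation_cons lerDr powR_ge0.
- by rewrite /= !variation_cons -!addrA lerD2l.
Qed.

Lemma variationN q x s : variation q (fun n => - x n) s = variation q x s.
Proof.
by apply: eq_bigr => i _; rewrite -opprD normrN.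
Qed.

Lemma variation_eq0 p x (c : R) s : 0 < p ->
  {in s, forall i, x i = c} -> variation p x s = 0.
Proof.
move=> p0; elim: s => [|a [|b s] IH] xc.
- exact: variation_nil.
- exact: variation_seq1.
- rewrite variation_cons IH ?addr0.
    by rewrite !xc ?inE ?eqxx ?orbT// subrr normr0 powR0// gt_eqF.
  by move=> i si; rewrite xc// in_cons si orbT.
Qed.

Lemma eq_in_variation p x y s :
  {in s, x =1 y} -> variation p x s = variation p y s.
Proof.
elim: s => [|a [|b s] IH] xy.
- by rewrite !variation_nil.
- by rewrite !variation_seq1.
- rewrite !variation_cons IH; last by move=> i si; rewrite xy// in_cons si orbT.
  by rewrite !xy ?inE ?eqxx ?orbT.
Qed.

Lemma cvg_powR_norm (T : Type) (F : set_system T) {FF : Filter F} q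
    (u : T -> R) (l : R) : 0 < q -> u @ F --> l ->
  `|u a| `^ q @[a --> F] --> `|l| `^ q.
Proof.
move=> q0 ul; have : `|u a| @[a --> F] --> `|l| by exact: cvg_norm.
(* The power map may fail to be differentiable at 0, so a zero limit is treated directly. *)
have [->|l0] := eqVneq l 0.
  rewrite normr0 powR0 ?gt_eqF// => /cvgrPdist_lt ul0.
  apply/cvgrPdist_lt => e e0.
  have e'0 : 0 < e `^ q^-1 by rewrite powR_gt0.
  move: (ul0 _ e'0); apply: filterS => a; rewrite !sub0r !normrN normr_id => ua.
  rewrite ger0_norm ?powR_ge0//.
  rewrite -[ltRHS]powRr1 ?(ltW e0)// -[1](mulVf (lt0r_neq0 q0)) powRrM.
  by apply: gt0_ltr_powR; rewrite ?nnegrE ?powR_ge0.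
have qc : {for `|l|, continuous (fun b : R => b `^ q)}.
  apply: differentiable_continuous; apply/derivable1_diffP.
  by apply: derivable_powR; rewrite in_itv/= andbT normr_gt0.
move=> nul; exact: (@cvg_comp _ _ _ (fun a => `|u a|) (fun b => b `^ q) F _ _ nul qc).
Qed.

Lemma cvg_variation (T : Type) (F : set_system T) {FF : Filter F} q
    (u : T -> nat -> R) x s : 0 < q -> (forall i, u a i @[a --> F] --> x i) ->
  variation q (u a) s @[a --> F] --> variation q x s.
Proof.
move=> q0 ux; rewrite /variation.
apply: cvg_big => [|i _]; first exact: add_continuous.
by apply: (cvg_powR_norm q0); apply: cvgB; exact: ux.
Qed.

(** The bound on values is separate because variation does not see constants. With no decay
    required, these sets are closed under pointwise limits, unlike the balls of J_q. *)
Definition bvar q w x := (forall i, `|x i| <= w) /\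
  forall s, sorted ltn s -> variation q x s <= w `^ q.

Lemma bvar_le q w w' x : 0 <= q -> 0 <= w -> w <= w' -> bvar q w x -> bvar q w' x.
Proof.
move=> q0 w0 ww [x1 x2]; split=> [i|s ss]; first exact: le_trans (x1 i) ww.
apply: le_trans (x2 s ss) _.
by apply: ge0_ler_powR; rewrite ?nnegrE// (le_trans w0).
Qed.

Lemma bvarN q w x : bvar q w x -> bvar q w (fun i => - x i).
Proof.
by move=> [x1 x2]; split=> [i|s ss]; rewrite ?normrN// variationN; exact: x2.
Qed.

Lemma bvarD q w w' x y : 1 <= q -> 0 < w -> 0 < w' ->
  bvar q w x -> bvar q w' y -> bvar q (w + w') (fun i => x i + y i).
Proof.
move=> q1 w0 w'0 [x1 x2] [y1 y2]; split=> [i|s ss].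
  by rewrite (le_trans (ler_normD _ _))// lerD.
by apply: variationD => //; [exact: x2|exact: y2].
Qed.

Lemma bvar_cvg (T : Type) (F : set_system T) {FF : ProperFilter F} q w
    (u : T -> nat -> R) x : 0 < q -> (forall a, bvar q w (u a)) ->
  (forall i, u a i @[a --> F] --> x i) -> bvar q w x.
Proof.
move=> q0 uw ux; split=> [i|s ss].
  apply: (cvgr_to_le (cvg_norm (ux i))).
  by apply: nearW => a; exact: (uw a).1.
have vx : variation q (u a) s @[a --> F] --> variation q x s by exact: cvg_variation.
apply: (cvgr_to_le vx).
by apply: nearW => a; exact: (uw a).2.
Qed.

(** Take [s] with variation within w^q of the supremum. A list beyond the last entry of [s] can be
    appended to it, so by superadditivity its own variation is at most w^q. *)
Lemma variation_tail q w M x : 0 < w -> bvar q M x ->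
  exists N, forall s, sorted ltn s -> all (leq N) s -> variation q x s <= w `^ q.
Proof.
move=> w0 [_ xM]; set E := [set variation q x s | s in [set s | sorted ltn s]].
have E0 : E !=set0 by exists (variation q x [::]), [::].
have supE : has_sup E.
  by split => //; exists (M `^ q) => _ [s ss <-]; exact: xM.
have [_ [s ss <-] hs] := sup_adherent (powR_gt0 q w0) supE.
exists (last 0 s).+1%N => t st tN.
have sst : sorted ltn (s ++ t).
  case: s ss tN {hs} => [//|a s] ss tN /=.
  rewrite cat_path; apply/andP; split; first exact: ss.
  case: t st tN => [//|b t] /= st /andP[tN _].
  by rewrite st andbT; exact: tN.
have := sup_upper_bound supE; move=> /(_ _ (ex_intro2 _ _ (s ++ t) sst erefl)) h.
have := variation_cat_ge q x s t; lra.
Qed.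

End variation_lemmas.

(** * Limits along an ultrafilter and iterated limits *)

Lemma ultra_cvg (R : realType) (U : set_system nat) (UU : UltraFilter U)
    (u : nat -> R) (M : R) : (forall a, `|u a| <= M) -> cvg (u @ U).
Proof.
move=> uM; have UP : ProperFilter U by exact: ultra_proper.
have Fu : (u @ U) [set` `[- M, M]].
  by apply: nearW => a /=; rewrite in_itv/= -ler_norml.
have [l [_ ul]] := @segment_compact R (- M) M (u @ U) (fmap_proper_filter u UP) Fu.
apply/cvg_ex; exists l => A Al.
(* For an ultrafilter a cluster point is a limit: otherwise the complement of some neighbourhood [A]
   would have its preimage in [U] and would have to meet [A]. *)
have [//|UnA] := in_ultra_setVsetC (u @^-1` A) UU.
by have [x [nAx Ax]] := ul (~` A) A UnA Al.
Qed.

Section iterated_limits.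
Context {R : realType} (U : set_system nat) {UU : UltraFilter U}.
Context (q w : R) (q1 : 1 <= q) (w0 : 0 < w).
Implicit Types (g h : seq nat -> nat -> R) (r : nat) (v : R).

Let q0 : 0 < q. Proof. exact: lt_le_trans q1. Qed.

(** The argument of [g] lists the entries still to be chosen, the limit in the first one being
    outermost. With [k] entries in all and [r] of them left, this is the g_(k-r) of the overview. *)
Fixpoint iterlim r g : nat -> R :=
  if r is r'.+1 then
    fun i => lim ((fun a => iterlim r' (fun t => g (a :: t)) i) @ U)
  else g [::].

(** The coordinate goes to infinity after the last [r] entries have done so, but inside the limits
    in the first [r']. This is what the value at infinity seen after fixing [r'] more entries tends
    to. *)
Fixpoint iterlim_infty r r' g : R :=
  if r' is r''.+1 then
    lim ((fun a => iterlim_infty r r'' (fun t => g (a :: t))) @ U)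
  else lim (iterlim r g @ U).

(** The second clause is a Lipschitz condition for the Hamming distance, uniform over all lists,
    whereas [M] may depend on [t]. *)
Definition tame g :=
  (forall t, exists M, bvar q M (g t)) /\
  forall s a b t, bvar q w (fun i => g (s ++ a :: t) i - g (s ++ b :: t) i).

Lemma tame_cons g a : tame g -> tame (fun t => g (a :: t)).
Proof. by move=> [g1 g2]; split=> [t|s b c t]; [exact: g1|exact: (g2 (a :: s))]. Qed.

Lemma ultra_cvg_lip (u : nat -> R) v : (forall a b, `|u a - u b| <= v) ->
  u @ U --> lim (u @ U).
Proof.
move=> uv; have := @ultra_cvg R U UU u (v + `|u 0|) => /(_ _)/cvg_ex.
case=> [a|l ul].
  by rewrite -[u a](subrK (u 0)) (le_trans (ler_normD _ _))// lerD2r.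
by rewrite (cvg_lim _ ul).
Qed.

Definition near_seq v g h := forall t, bvar q v (fun i => g t i - h t i).

Lemma tame_near g a b : tame g ->
  near_seq w (fun t => g (a :: t)) (fun t => g (b :: t)).
Proof. by move=> [_ g2] t; exact: (g2 [::]). Qed.

Lemma near_seq_cons v g h a : near_seq v g h ->
  near_seq v (fun t => g (a :: t)) (fun t => h (a :: t)).
Proof. by move=> gh t; exact: gh. Qed.

Lemma iterlim_dist r v g h : tame g -> tame h -> near_seq v g h ->
  bvar q v (fun i => iterlim r g i - iterlim r h i).
Proof.
elim: r v g h => [|r IH] v g h tg th gh /=; first exact: gh.
(* The limits exist by the induction hypothesis itself, applied to two choices of the first
   entry. *)
have cv f i : tame f -> (fun a => iterlim r (fun t => f (a :: t)) i) @ U -->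
    iterlim r.+1 f i.
  move=> tf; apply: (@ultra_cvg_lip _ w) => a b.
  by apply: (IH _ _ _ _ _ (tame_near a b tf)).1; exact: tame_cons.
apply: (@bvar_cvg R nat U _ q v (fun a i => iterlim r (fun t => g (a :: t)) i -
   iterlim r (fun t => h (a :: t)) i)) => // [a|i].
  by apply: IH; [exact: tame_cons|exact: tame_cons|exact: near_seq_cons].
by apply: cvgB; exact: cv.
Qed.

Lemma cvg_iterlim r g i : tame g ->
  iterlim r (fun t => g (a :: t)) i @[a --> U] --> iterlim r.+1 g i.
Proof.
move=> tg; apply: (@ultra_cvg_lip _ w) => a b.
by apply: (iterlim_dist _ _ _ (tame_near a b tg)).1; exact: tame_cons.
Qed.

(** Replacing a first entry [b] by [a] costs at most [w], uniformly in [b]; now let [b] run along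
    [U]. *)
Lemma iterlim_incr r g a : tame g ->
  bvar q w (fun i => iterlim r (fun t => g (a :: t)) i - iterlim r.+1 g i).
Proof.
move=> tg.
apply: (@bvar_cvg R nat U _ q w (fun b i => iterlim r (fun t => g (a :: t)) i -
   iterlim r (fun t => g (b :: t)) i)) => // [b|i].
  by apply: iterlim_dist (tame_near a b tg); exact: tame_cons.
by apply: cvgB; [exact: cvg_cst|exact: cvg_iterlim].
Qed.

Lemma iterlim_bvar r g : tame g -> exists2 M, 0 < M & bvar q M (iterlim r g).
Proof.
elim: r g => [|r IH] g tg.
  have [M gM] := tg.1 [::].
  have M0 : 0 <= M by apply: le_trans (gM.1 0).
  by exists (M + 1); [rewrite ltr_wpDl|apply: bvar_le gM => //; [exact: ltW|rewrite lerDl]].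
have [M M0 gM] := IH _ (tame_cons 0 tg).
exists (w + M); first exact: addr_gt0.
have := bvarD q1 w0 M0 (bvarN (iterlim_incr r 0 tg)) gM.
by congr (bvar _ _ _); apply/funext => i; rewrite opprB subrK.
Qed.

Lemma cvg_iterlim_infty0 r g : tame g ->
  iterlim r g i @[i --> U] --> iterlim_infty r 0 g.
Proof.
move=> /(iterlim_bvar r)[M M0 [gM _]]; apply: (@ultra_cvg_lip _ (M + M)) => a b.
by rewrite (le_trans (ler_normB _ _))// lerD.
Qed.

Lemma iterlim_infty_dist r r' v g h : tame g -> tame h -> near_seq v g h ->
  `|iterlim_infty r r' g - iterlim_infty r r' h| <= v.
Proof.
elim: r' v g h => [|r' IH] v g h tg th gh.
  have c : `|iterlim r g i - iterlim r h i| @[i --> U] -->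
      `|iterlim_infty r 0 g - iterlim_infty r 0 h|.
    by apply: cvg_norm; apply: cvgB; exact: cvg_iterlim_infty0.
  apply: (cvgr_to_le c); apply: nearW => i.
  exact: (iterlim_dist r tg th gh).1.
have cv f : tame f -> (fun a => iterlim_infty r r' (fun t => f (a :: t))) @ U -->
    iterlim_infty r r'.+1 f.
  move=> tf; apply: (@ultra_cvg_lip _ w) => a b.
  by apply: IH (tame_near a b tf); exact: tame_cons.
have c : `|iterlim_infty r r' (fun t => g (a :: t)) -
    iterlim_infty r r' (fun t => h (a :: t))| @[a --> U] -->
    `|iterlim_infty r r'.+1 g - iterlim_infty r r'.+1 h|.
  by apply: cvg_norm; apply: cvgB; exact: cv.
apply: (cvgr_to_le c); apply: nearW => a.
by apply: IH; [exact: tame_cons|exact: tame_cons|exact: near_seq_cons].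
Qed.

Lemma cvg_iterlim_infty r r' g : tame g ->
  iterlim_infty r r' (fun t => g (a :: t)) @[a --> U] --> iterlim_infty r r'.+1 g.
Proof.
move=> tg; apply: (@ultra_cvg_lip _ w) => a b.
by apply: iterlim_infty_dist (tame_near a b tg); exact: tame_cons.
Qed.

End iterated_limits.

(** * Splitting lists of indices at a threshold *)

Lemma sorted_ltn_split N s : sorted ltn s -> exists s1 s2,
  [/\ s = s1 ++ s2, sorted ltn s1, sorted ltn s2, all (fun i => i < N)%N s1 &
      all (leq N) s2].
Proof.
elim: s => [_|a s IH ss]; first by exists [::], [::].
have [Na|aN] := leqP N a.
  exists [::], (a :: s); split=> //=; rewrite Na /=.
  apply: sub_all (order_path_min ltn_trans ss) => i /=.
  by move=> /ltnW; exact: leq_trans.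
have [s1 [s2 [e ss1 ss2 s1N s2N]]] := IH (path_sorted ss).
exists (a :: s1), s2; split=> //=; [by rewrite e| |by rewrite aN].
by move: ss => /=; rewrite e cat_path => /andP[].
Qed.

(* Only finitely many lists are tested, namely the sublists of [iota 0 N]. *)
Lemma filter_sorted_below (T : Type) (F : set_system T) {FF : Filter F} N
    (P : T -> seq nat -> Prop) :
  (forall s, sorted ltn s -> all (fun i => i < N)%N s -> \forall a \near F, P a s) ->
  \forall a \near F, forall s, sorted ltn s -> all (fun i => i < N)%N s -> P a s.
Proof.
move=> h.
have : F [set a | forall m : N.-tuple bool, P a (mask m (iota 0 N))].
  apply: filter_forall => m; apply: h.
    by apply: sorted_mask (iota_ltn_sorted _ _); exact: ltn_trans.
  apply/allP => i /mem_mask; rewrite mem_iota add0n.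
  by case/andP.
apply: filterS => a /= Pa s ss /allP sN.
have -> : s = mask [tuple (i : nat) \in s | i < N] (iota 0 N).
  rewrite /= map_comp val_enum_ord -filter_mask.
  apply: (irr_sorted_eq ltn_trans ltnn ss).
    by apply: sorted_filter (iota_ltn_sorted _ _); exact: ltn_trans.
  move=> i; rewrite mem_filter mem_iota add0n /=.
  by apply/idP/andP => [si|[]//]; split=> //; exact: sN.
exact: Pa.
Qed.

Notation interleave ps := (flatten [seq [:: p.1; p.2] | p <- ps]).

(** * Choosing the interlaced lists one entry at a time *)

Section block_control.
Context {R : realType} (U : set_system nat) {UU : UltraFilter U}.
Context (Uoo : \oo `<=` U).
Context (q w : R) (q1 : 1 <= q) (w0 : 0 < w).
Implicit Types (D : nat -> R) (g h : seq nat -> nat -> R) (r N : nat) (c : R).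

Let q0 : 0 < q. Proof. exact: lt_le_trans q1. Qed.

(** The inequalities are strict and concern finitely many coordinates, so they pass from a pointwise
    limit along [U] to the sequences near it. The bound [5 * w] leaves room above the
    [2 * w + 2 * w] met in [head_control_extend]. *)
Definition head_control c N D :=
  (forall s, sorted ltn s -> all (fun i => i < N)%N s -> variation q D s < c) /\
  (forall i, (i < N)%N -> `|D i| < 5 * w).

Definition tail_control N D :=
  (forall s, sorted ltn s -> all (leq N) s -> variation q D s <= w `^ q) /\
  (forall i, (N <= i)%N -> `|D i| <= 2 * w).

(** Split [s] at [N]. The head costs less than [c]; the junction costs at most (10w)^q, as [D'] is
    bounded by [5 * w]; on the tail [D' - D] and [D] together cost at most (2w + w)^q. The increase
    is additive in q-th powers, whence the final k^(1/q). *)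
Lemma control_variation c N D D' s :
  head_control c N D' -> tail_control N D -> bvar q (2 * w) (fun i => D' i - D i) ->
  sorted ltn s -> variation q D' s < c + 2 * (10 * w) `^ q.
Proof.
move=> [h1 h2] [t1 t2] [d1 d2] ss.
have [s1 [s2 [-> ss1 ss2 s1N s2N]]] := sorted_ltn_split N ss.
have D'5 i : `|D' i| <= 5 * w.
  have [Ni|/h2/ltW//] := leqP N i.
  have := ler_normD (D' i - D i) (D i); rewrite subrK.
  have := d1 i; have := t2 i Ni; have := w0; lra.
have D'10 i j : `|D' i - D' j| <= 10 * w.
  by rewrite (le_trans (ler_normB _ _))//; have := D'5 i; have := D'5 j; lra.
have w10 : 0 <= 10 * w by rewrite mulr_ge0// ltW.
have w20 : 0 < 2 * w by rewrite mulr_gt0.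
apply: le_lt_trans (le_variation_cat s1 s2 (ltW q0) w10 D'10) _.
have v2 : variation q D' s2 <= (10 * w) `^ q.
  have : variation q D' s2 <= (2 * w + w) `^ q.
    have -> : D' = (fun i => (D' i - D i) + D i) by apply/funext => i; rewrite subrK.
    by apply: variationD => //; [exact: d2|exact: t1].
  move=> /le_trans; apply; apply: ge0_ler_powR; rewrite ?nnegrE ?(ltW q0)//; have := w0; lra.
have := h1 _ ss1 s1N; lra.
Qed.

Lemma control_variation_self c N D s :
  head_control c N D -> tail_control N D ->
  sorted ltn s -> variation q D s < c + 2 * (10 * w) `^ q.
Proof.
move=> hD tD; apply: control_variation hD tD _; split=> [i|t _].
  by rewrite subrr normr0 mulr_ge0// ltW.
rewrite /variation big1 ?powR_ge0// => i _.
by rewrite !subrr normr0 powR0// gt_eqF.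
Qed.

Lemma head_control_extend c N N' D D' : (N <= N')%N ->
  head_control c N D' -> tail_control N D -> bvar q (2 * w) (fun i => D' i - D i) ->
  head_control (c + 2 * (10 * w) `^ q) N' D'.
Proof.
move=> NN' hD' tD dD; split=> [s ss _|i _]; first exact: control_variation hD' tD dD ss.
have [Ni|/hD'.2//] := leqP N i.
have := ler_normD (D' i - D i) (D i); rewrite subrK.
have := dD.1 i; have := tD.2 i Ni; have := w0; lra.
Qed.

(** Past the [N] of [variation_tail] two values differ by at most [w]. Comparing [D i] with [D j]
    for some [j > i] far along [U], where [D j] is below [w] in absolute value, gives [2 * w]. *)
Lemma tail_controlP M (l : R) D : bvar q M D -> D @ U --> l -> `|l| < w ->
  exists N, tail_control N D.
Proof.
move=> /(variation_tail w0)[N hN] Dl lw; exists N; split=> // i Ni.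
have UP : ProperFilter U by exact: ultra_proper.
have Ui : \forall j \near U, (i < j)%N by apply: Uoo; exact: nbhs_infty_gt.
have Uw : \forall j \near U, `|D j| < w by exact: (cvgr_norm_lt _ Dl).
have [j [ij Djw]] := filter_ex (filterI Ui Uw).
have := hN [:: i; j]; rewrite /= ij Ni (leq_trans Ni (ltnW ij)) => /(_ isT isT).
rewrite variation2.
have qV0 : 0 <= q^-1 by rewrite invr_ge0 ltW.
move=> /(ge0_ler_powR qV0); rewrite !nnegrE !powR_ge0 -!powRrM mulfV ?gt_eqF//.
rewrite !powRr1 ?(ltW w0)// => /(_ isT isT) Dij.
have := ler_normB (D j) (D j - D i); rewrite subKr => Di.
by rewrite (le_trans Di)// mulrDl mul1r lerD// ltW.
Qed.

Lemma near_head_control c N (x : nat -> nat -> R) D :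
  (forall i, x a i @[a --> U] --> D i) -> head_control c N D ->
  \forall a \near U, head_control c N (x a).
Proof.
move=> xD [h1 h2]; have UP : ProperFilter U by exact: ultra_proper.
apply: filterI.
  apply: filter_sorted_below => s ss sN.
  have cv : variation q (x a) s @[a --> U] --> variation q D s.
    exact: cvg_variation.
  exact: (cvgr_lt _ cv) (h1 s ss sN).
have : U [set a | forall i : 'I_N, `|x a i| < 5 * w].
  apply: filter_forall => i.
  exact: (cvgr_norm_lt _ (xD i)) (h2 i (ltn_ord i)).
by apply: filterS => a /= xa i iN; exact: (xa (Ordinal iN)).
Qed.

Lemma near_lt_norm r (x : nat -> nat -> R) (l : nat -> R) :
  (forall i, (i <= r)%N -> x a i @[a --> U] --> l i) ->
  (forall i, (i <= r)%N -> `|l i| < w) ->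
  \forall a \near U, forall i, (i <= r)%N -> `|x a i| < w.
Proof.
move=> xl lw; have UP : ProperFilter U by exact: ultra_proper.
have : U [set a | forall i : 'I_r.+1, `|x a i| < w].
  apply: filter_forall => i; have ir : (i <= r)%N by rewrite -ltnS.
  exact: (cvgr_norm_lt _ (xl i ir)) (lw i ir).
by apply: filterS => a /= xa i iN; exact: (xa (Ordinal (iN : i < r.+1)%N)).
Qed.

(** Induction on the number [r] of pairs still to choose, [g] and [h] being already specialised to
    the chosen entries. Each pair costs 2(10w)^q, and so does the final estimate at [r = 0].
    Smallness at infinity is only preserved by later choices, never created, so it is assumed for
    every [r'] from the start. *)
Lemma interlaced_variation r g h N N0 c :
  tame q w g -> tame q w h ->
  head_control c N (fun i => iterlim U r g i - iterlim U r h i) ->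
  tail_control N (fun i => iterlim U r g i - iterlim U r h i) ->
  (forall r', (r' <= r)%N ->
     `|iterlim_infty U (r - r') r' g - iterlim_infty U (r - r') r' h| < w) ->
  exists ps : seq (nat * nat), [/\ size ps = r, path ltn N0 (interleave ps) &
    forall s, sorted ltn s ->
      variation q (fun i => g (map fst ps) i - h (map snd ps) i) s <
      c + r.+1%:R * (2 * (10 * w) `^ q)].
Proof.
have UP : ProperFilter U by exact: ultra_proper.
elim: r g h N N0 c => [|r IH] g h N N0 c tg th hD tD hlim.
  exists [::]; split=> // s ss; rewrite mul1r.
  exact: (control_variation_self hD tD ss).
have Ugt n : \forall j \near U, (n < j)%N by apply: Uoo; exact: nbhs_infty_gt.
pose ga a := fun t => g (a :: t).
pose ha a := fun t => h (a :: t).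
have tga a : tame q w (ga a) by exact: tame_cons.
have tha a : tame q w (ha a) by exact: tame_cons.
(* First [a] is chosen while the first entry of [h] is still at infinity, then [b] with [a]
   fixed. *)
have Ua1 : \forall a \near U,
    head_control c N (fun i => iterlim U r (ga a) i - iterlim U r.+1 h i).
  apply: near_head_control hD => i; apply: cvgB; [exact: (cvg_iterlim q1 tg)|exact: cvg_cst].
have hlim' r' : (r' <= r)%N ->
  `|iterlim_infty U (r - r') r'.+1 g - iterlim_infty U (r - r') r'.+1 h| < w.
  by move=> rr; have := hlim r'.+1 rr; rewrite subSS.
have Ua2 : \forall a \near U, forall r', (r' <= r)%N ->
    `|iterlim_infty U (r - r') r' (ga a) - iterlim_infty U (r - r') r'.+1 h| < w.
  apply: near_lt_norm hlim' => r' _; apply: cvgB;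
    [exact: (cvg_iterlim_infty q1 w0 tg)|exact: cvg_cst].
have [a [[N0a a1] a2]] := filter_ex (filterI (filterI (Ugt N0) Ua1) Ua2).
have Ub1 : \forall b \near U,
    head_control c N (fun i => iterlim U r (ga a) i - iterlim U r (ha b) i).
  apply: near_head_control a1 => i; apply: cvgB; [exact: cvg_cst|exact: (cvg_iterlim q1 th)].
have Ub2 : \forall b \near U, forall r', (r' <= r)%N ->
    `|iterlim_infty U (r - r') r' (ga a) - iterlim_infty U (r - r') r' (ha b)| < w.
  apply: near_lt_norm a2 => r' _; apply: cvgB;
    [exact: cvg_cst|exact: (cvg_iterlim_infty q1 w0 th)].
have [b [[ab b1] b2]] := filter_ex (filterI (filterI (Ugt a) Ub1) Ub2).
pose D' i := iterlim U r (ga a) i - iterlim U r (ha b) i.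
(* Fixing [a] and fixing [b] cost [w] each. *)
have dD : bvar q (2 * w) (fun i => D' i - (iterlim U r.+1 g i - iterlim U r.+1 h i)).
  have -> : 2 * w = w + w by rewrite mulr_natl.
  have := bvarD q1 w0 w0 (iterlim_incr (U := U) q1 r a tg)
    (bvarN (iterlim_incr (U := U) q1 r b th)).
  move=> /(_ UU UU); congr (bvar _ _ _); apply/funext => i.
  by rewrite /D' /ga /ha !opprD !opprK addrACA.
have [M D'M] : exists M, bvar q M D'.
  have [M1 M10 gM1] := iterlim_bvar (U := U) q1 w0 r (tga a).
  have [M2 M20 hM2] := iterlim_bvar (U := U) q1 w0 r (tha b).
  exists (M1 + M2); exact: bvarD (bvarN hM2).
have [N1 tN1] : exists N1, tail_control N1 D'.
  apply: (tail_controlP D'M (cvgB (cvg_iterlim_infty0 q1 w0 (tga a))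
    (cvg_iterlim_infty0 q1 w0 (tha b)))).
  (* The case [r' = 0] is the value at infinity of [D'] itself. *)
  by have := b2 0%N (leq0n _); rewrite subn0.
pose N' := maxn N N1.
have tN' : tail_control N' D'.
  have [t1 t2] := tN1; split=> [s ss sN|i iN]; last first.
    by apply: t2; apply: leq_trans iN; exact: leq_maxr.
  by apply: t1 => //; apply: sub_all sN => i; apply: leq_trans; exact: leq_maxr.
(* The threshold can rise to [N'] because the previous difference was already small beyond [N]. *)
have hN' := head_control_extend (leq_maxl N N1) b1 tD dD.
have [ps [sps pps psv]] := IH (ga a) (ha b) N' b _ (tga a) (tha b) hN' tN' b2.
exists ((a, b) :: ps); split=> [||s ss]; first by rewrite /= sps.
  by rewrite /= N0a ab.
by rewrite -[r.+2%:R]natr1 mulrDl mul1r [X in c + X]addrC addrA; exact: psv.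
Qed.

End block_control.

(** * Sums of initial segments in J_p *)

Section james_vectors.
Context {R : realType} (p : R) (p1 : 1 <= p).
Implicit Types (a b : nat) (n : seq nat).

Let p0 : 0 < p. Proof. exact: lt_le_trans p1. Qed.

Definition step a : nat -> R := fun i => (i < a)%N%:R.

(** The sequence is constant on each side of [a], so only the junction counts. *)
Lemma variation_step a s : sorted ltn s -> variation p (step a) s <= 1 `^ p.
Proof.
move=> /(sorted_ltn_split a)[s1 [s2 [-> _ _ /allP s1a /allP s2a]]].
apply: le_trans (le_variation_cat _ _ (ltW p0) ler01 _) _ => [i j|].
  by rewrite /step; case: (i < a)%N; case: (j < a)%N;
    rewrite ?subrr ?subr0 ?sub0r ?normrN ?normr0 ?normr1.
rewrite (variation_eq0 (c := 1))// ?(variation_eq0 (c := 0)) ?add0r// => i si.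
  by rewrite /step ltnNge s2a.
by rewrite /step s1a.
Qed.

Lemma step_james a : step a \in james_seq p1.
Proof.
apply/james_seqP; split; last by exists 1 => // s; exact: variation_step.
apply: cvg_near_cst; near=> i; rewrite /step ltnNge.
by have -> : (a <= i)%N by near: i; exact: nbhs_infty_ge.
Unshelve. all: by end_near. Qed.

Definition jstep a : james p1 := James (step_james a).

Lemma norm_jstep a : `|jstep a| <= 1.
Proof.
by apply/(le_james_normP (jstep a) ler01) => s; exact: variation_step.
Qed.

Definition jstep_sum n : james p1 := \sum_(a <- n) jstep a.

Lemma norm_jstep_sum n : `|jstep_sum n| <= (size n)%:R.
Proof.
rewrite /jstep_sum; elim: n => [|a n IH]; first by rewrite big_nil normr0.
by rewrite big_cons (le_trans (ler_normD _ _))//= -nat1r lerD// norm_jstep.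
Qed.

Lemma norm_jstep_sum_replace s a b t :
  `|jstep_sum (s ++ a :: t) - jstep_sum (s ++ b :: t)| <= 2.
Proof.
rewrite /jstep_sum !big_cat !big_cons /= opprD addrACA subrr add0r.
rewrite opprD addrACA subrr addr0 (le_trans (ler_normB _ _))//.
by rewrite -[2]/(1 + 1) lerD// norm_jstep.
Qed.

#[local] Arguments james_val : simpl never.

Definition jdiff (ps : seq (nat * nat)) : james p1 :=
  jstep_sum (map fst ps) - jstep_sum (map snd ps).

Lemma jdiff_cons ab ps i :
  jdiff (ab :: ps) i = step ab.1 i - step ab.2 i + jdiff ps i.
Proof.
by rewrite /jdiff /jstep_sum /= !big_cons opprD addrACA.
Qed.

Lemma jdiff_below N ps i : path ltn N (interleave ps) -> (i <= N)%N -> jdiff ps i = 0.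
Proof.
elim: ps N => [|[a b] ps IH] N.
  by move=> _ _; rewrite /jdiff /jstep_sum /= !big_nil subrr.
rewrite jdiff_cons /= => /and3P[Na ab ps_path] iN.
have ia : (i < a)%N by apply: leq_ltn_trans Na.
have ib : (i < b)%N by apply: ltn_trans ab.
by rewrite (IH b)// ?(ltnW ib)// /step ia ib subrr addr0.
Qed.

(** Here [jdiff ps] is minus the indicator of the disjoint intervals [a, b) given by the pairs, so
    going from [a] to [b] yields an increment 1 for each pair. *)
Lemma variation_jdiff N ps : path ltn N (interleave ps) ->
  (size ps)%:R <= variation p (jdiff ps) (interleave ps).
Proof.
elim: ps N => [|[a b] ps IH] N /=; first by rewrite variation_nil.
move=> /and3P[Na ab ps_path].
apply: le_trans (variation_cat_ge p (jdiff ((a, b) :: ps)) [:: a; b] (interleave ps)).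
rewrite -nat1r lerD//.
  rewrite variation2 !jdiff_cons /= !(jdiff_below ps_path)// ?(ltnW ab)//.
  rewrite /step ltnn ab ltnn (ltnNge b) (ltnW ab) /= !addr0 subrr !sub0r opprK.
  by rewrite normr1 powR1.
(* Beyond [b] both steps of the first pair vanish. *)
apply: le_trans (IH b ps_path) _; rewrite le_eqVlt; apply/orP; left; apply/eqP.
apply: eq_in_variation => i ips; rewrite jdiff_cons /=.
have bi : (b < i)%N by have /allP := order_path_min ltn_trans ps_path; exact.
by rewrite /step [(i < a)%N]ltnNge (ltnW (ltn_trans ab bi)) ltnNge (ltnW bi) subrr add0r.
Qed.

Lemma norm_jdiff_ge N ps : path ltn N (interleave ps) ->
  (size ps)%:R `^ p^-1 <= `|jdiff ps|.
Proof.
move=> pps; have vps := variation_jdiff pps.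
have := (le_james_normP (jdiff ps) (james_norm_ge0 _)).1 (lexx _) _ (path_sorted pps).
move=> /(le_trans vps) h.
have pV0 : 0 <= p^-1 by rewrite invr_ge0 ltW.
have := ge0_ler_powR pV0 _ _ h; rewrite !nnegrE powR_ge0 ler0n => /(_ isT isT).
by rewrite -powRrM mulfV ?gt_eqF// powRr1// james_norm_ge0.
Qed.

End james_vectors.

(** * Images under a coarse map, and the contradiction with linear expansion *)

Section maps_into_james.
Context {R : realType} (p q : R) (p1 : 1 <= p) (q1 : 1 <= q).
Implicit Types f : james p1 -> james q1.

Let q0 : 0 < q. Proof. exact: lt_le_trans q1. Qed.

Lemma coarse_bound f (t : R) : 0 <= t -> coarse f ->
  exists2 w : R, 0 < w & forall x z, `|x - z| <= t -> `|f x - f z| <= w.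
Proof.
move=> t0 /(_ t t0) ft.
have h x z : `|x - z| <= t -> (`|f x - f z|%:E <= expansion_modulus f t)%E.
  by move=> xz; apply: ereal_sup_ubound; exists (x, z).
move: ft h; case: (expansion_modulus f t) => [r| |]// _ h.
  exists (Num.max 1 r) => [|x z xz]; first by rewrite lt_max ltr01.
  by have := h x z xz; rewrite lee_fin le_max => ->; rewrite orbT.
by exists 1 => // x z xz; have := h x z xz; rewrite leeNy_eq.
Qed.

Lemma bvar_james (y : james q1) (v : R) : `|y| <= v -> bvar q v y.
Proof.
move=> yv; split=> [i|]; first exact: le_trans (ler_james_norm y i) yv.
by apply: (le_james_normP y _).1 => //; exact: le_trans yv.
Qed.

Lemma interlaced_images_close f (w : R) (k : nat) : (0 < k)%N -> 0 < w ->
  (forall x z, `|x - z| <= 2 -> `|f x - f z| <= w) ->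
  exists ps : seq (nat * nat), [/\ size ps = k, path ltn 0 (interleave ps) &
    `|f (jstep_sum p1 (map fst ps)) - f (jstep_sum p1 (map snd ps))|
      <= 10 * w * (5 * k%:R) `^ q^-1].
Proof.
move=> k0 w0 fw.
have [U [UU Uoo]] := @ultraFilterLemma nat \oo _.
pose g n : nat -> R := f (jstep_sum p1 n).
have tg : tame q w g.
  split=> [t|s a b t]; first by exists `|f (jstep_sum p1 t)|; exact: bvar_james.
  apply: (@bvar_james (f (jstep_sum p1 (s ++ a :: t)) - f (jstep_sum p1 (s ++ b :: t)))).
  by apply: fw; exact: norm_jstep_sum_replace.
have w10 : 0 < (10 * w) `^ q by rewrite powR_gt0// mulr_gt0.
have zero (D : nat -> R) : (fun i => D i - D i) = fun=> 0 by apply/funext => i; rewrite subrr.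
(* Both families are [g], so the initial difference is 0 and any positive [c] would do; (10w)^q
   matches the cost of the steps. *)
have [||r' _|ps [sps pps psv]] := @interlaced_variation R U UU Uoo q w q1 w0 k g g
    0 0 ((10 * w) `^ q) tg tg.
- split=> [[|//] _ _|//]; by rewrite variation_nil.
- rewrite zero; split=> [s _ _|i _]; last by rewrite normr0 mulr_ge0// ltW.
  by rewrite (variation_eq0 (c := 0))// powR_ge0.
- by rewrite subrr normr0.
exists ps; split=> //.
have B0 : 0 <= 10 * w * (5 * k%:R) `^ q^-1 by rewrite mulr_ge0 ?powR_ge0// mulr_ge0// ltW.
apply/(le_james_normP (f _ - f _) B0) => s ss.
apply: le_trans (ltW (psv s ss)) _.
have -> : (10 * w * (5 * k%:R) `^ q^-1) `^ q = (10 * w) `^ q * (5 * k%:R).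
  rewrite powRM ?powR_ge0//; last by rewrite mulr_ge0// ltW.
  by rewrite -powRrM mulVf ?gt_eqF// powRr1// mulr_ge0.
(* The total is (10w)^q times 1 + 2(k + 1), and 2k + 3 <= 5k since k >= 1. *)
rewrite -{1}[(10 * w) `^ q]mulr1 mulrA [_ * (10 * w) `^ q]mulrC -mulrDr.
rewrite ler_wpM2l ?(ltW w10)//.
have : (1 : R) <= k%:R by rewrite ler1n.
rewrite -natr1; lra.
Qed.

End maps_into_james.

(** The summand 2 of [A] gives the first inequality, since t >= 1. Divided by [C], the other summand
    contributes t(B + C + 1), which already exceeds Bt + C. *)
Lemma expansion_beats_rate (R : realType) (t A B C : R) :
  1 <= t -> 0 <= B -> 0 < C -> A = 2 + C * (B + C + 1) ->
  t + 1 <= t * A /\ C^-1 * (t * A) - C > B * t.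
Proof.
move=> t1 B0 C0 ->.
have tC : 0 <= (t - 1) * (C * C) by rewrite mulr_ge0 ?subr_ge0// mulr_ge0 ?ltW.
have tC0 : 0 <= t * C by rewrite mulr_ge0 ?(ltW C0)//; lra.
have tCB : 0 <= t * C * B by rewrite mulr_ge0.
have C20 : 0 <= C * C by rewrite mulr_ge0 ?ltW.
split; first by lra.
by rewrite ltrBrDr [ltRHS]mulrC ltr_pdivlMr//; lra.
Qed.

Theorem corollary4p13 (R : realType) (p q : R) (p1 : 1 <= p) (q1 : 1 <= q) :
  p < q ->
  ~ exists f : james p1 -> james q1, coarse f /\ linearly_expanding q^-1 f.
Proof.
move=> pq [f [/(coarse_bound (ler0n R 2))[w w0 fw] /(_ 1 ltr01)[C C0 fC]]].
have p0 := lt_le_trans ltr01 p1.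
have q0 := lt_le_trans ltr01 q1.
pose e := p^-1 - q^-1; have e0 : 0 < e by rewrite subr_gt0 ltf_pV2.
pose B := 10 * w * 5 `^ q^-1.
have B0 : 0 <= B by rewrite mulr_ge0 ?powR_ge0// mulr_ge0// ltW.
pose A := 2 + C * (B + C + 1).
have A0 : 0 < A by rewrite ltr_wpDr// mulr_ge0 ?(ltW C0)// !addr_ge0// ltW.
(* Since 1/p = 1/q + e, the lower bound k^(1/p) on the distance of the two sums is k^(1/q) k^e,
   hence at least A k^(1/q) for this [k]. *)
have [k k0 kA] : exists2 k : nat, (0 < k)%N & A <= k%:R `^ e.
  exists (Num.bound (A `^ e^-1)).+1 => //; set k := _.+1.
  have : A `^ e^-1 <= k%:R.
    apply: le_trans (ltW (archi_boundP (powR_ge0 _ _))) _.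
    by rewrite ler_nat.
  move=> /(ge0_ler_powR (ltW e0)); rewrite !nnegrE powR_ge0 ler0n -powRrM.
  by rewrite mulVf ?gt_eqF// powRr1 ?(ltW A0)//; exact.
have k1 : (1 : R) <= k%:R by rewrite ler1n.
have [ps [sps pps fps]] := interlaced_images_close k0 w0 fw.
set x := jstep_sum p1 (map fst ps) in fps; set z := jstep_sum p1 (map snd ps) in fps.
pose t : R := k%:R `^ q^-1.
have t1 : 1 <= t.
  have -> : 1 = 1 `^ q^-1 :> R by rewrite powR1.
  by rewrite ge0_ler_powR ?nnegrE ?invr_ge0 ?(ltW q0).
have xz : t * k%:R `^ e <= `|x - z|.
  rewrite /t -powRD; last by rewrite (gt_eqF (lt_le_trans ltr01 k1)) implybT.
  by rewrite addrC subrK -sps; exact: (norm_jdiff_ge p1 pps).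
have le_t (r : R) : 0 <= r -> r <= k%:R -> r `^ q^-1 <= t.
  by move=> r0 rk; rewrite ge0_ler_powR ?nnegrE ?invr_ge0 ?(ltW q0).
have xt : `|x| `^ q^-1 <= t.
  by apply: le_t (normr_ge0 _) _; rewrite -sps -(size_map fst); exact: norm_jstep_sum.
have zt : `|z| `^ q^-1 <= t.
  by apply: le_t (normr_ge0 _) _; rewrite -sps -(size_map snd); exact: norm_jstep_sum.
have tA : t * A <= `|x - z|.
  by apply: le_trans xz; rewrite ler_wpM2l// (le_trans ler01).
have t0 : 0 <= t by exact: le_trans t1.
have [At CA] := expansion_beats_rate t1 B0 C0 (erefl A).
(* Both norms are at most [k], so the threshold for L = 1 is at most [t + 1]. *)
have /fC : 1 * Num.max (`|x| `^ q^-1) (`|z| `^ q^-1) + 1 <= `|x - z|.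
  apply: (le_trans _ (le_trans At tA)).
  by rewrite mul1r lerD2r ge_max; apply/andP; split; [exact: xt|exact: zt].
apply/negP; rewrite -ltNge (le_lt_trans fps)//.
rewrite powRM// mulrA -/B -/t (lt_le_trans CA)//.
by rewrite lerD2r ler_pM2l ?invr_gt0.
Qed.
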